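(* Let $F$ be an RS-fan, let $g_1,g_2\in X_F$, and let $I\in\mathrm{Spec}(F)$ be such that $Z(g_1),Z(g_2)\subseteq I$. For every such $I$, let $\varphi_I^{g_1,g_2}:L_I(F)\to L_I(F)$ be the map $\varphi_I^{g_1,g_2}(h)=h\,g_1g_2$ (pointwise product). Then: (a) $\varphi_I^{g_1,g_2}$ is an AOS-automorphism of $L_I$. (b) $\varphi_I^{g_1,g_2}$ is an involution: $\varphi_I^{g_1,g_2}(\varphi_I^{g_1,g_2}(h))=h$ for all $h\in L_I$. (c) For $i=1,2$ let $h_i$ be the unique element of $L_I$ with $g_i\rightsquigarrow h_i$. Then $\varphi_I^{g_1,g_2}(h_1)=h_2$. (d) In particular, if $g_1,g_2$ have a common specialization $h$ at some level $I\supseteq Z(g_1),Z(g_2)$ (i.e. $h\in L_I$, $g_1\rightsquigarrow h$, $g_2\rightsquigarrow h$), then $h$ is a fixed point of $\varphi_I^{g_1,g_2}$. (e) Let $J\subseteq I$ be in $\mathrm{Spec}(F)$ with $Z(g_1),Z(g_2)\subseteq J$, and let $h_1\in L_J$, $h_2\in L_I$. Then $$h_1\rightsquigarrow h_2\ \Longrightarrow\ \varphi_J^{g_1,g_2}(h_1)\rightsquigarrow\varphi_I^{g_1,g_2}(h_2).$$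
   Context: A ternary semigroup (TS) is a commutative monoid $(T,\cdot,1)$ with distinguished elements $0,-1$ such that, for all $x$: $x^3=x$; $x\cdot 0=0$; $-1\neq 1$ and $(-1)(-1)=1$; and $x=-x$ implies $x=0$ (where $-x:=(-1)\cdot x$). $\mathbf 3=\{1,0,-1\}$ with the usual multiplication is a TS. A real semigroup (RS) is a TS $G$ with a ternary relation ''$a\in D(b,c)$'' such that, writing $a\in D^t(b,c)$ for [$a\in D(b,c)$ and $-b\in D(-a,c)$ and $-c\in D(b,-a)$], for all $a,b,c,d,e\in G$: (RS0) $c\in D(a,b)\Leftrightarrow c\in D(b,a)$; (RS1) $a\in D(a,b)$; (RS2) $a\in D(b,c)\Rightarrow ad\in D(bd,cd)$; (RS3) $a\in D^t(b,c)$ and $c\in D^t(d,e)$ imply there is $x\in D^t(b,d)$ with $a\in D^t(x,e)$; (RS4) $e\in D(c^2a,d^2b)\Rightarrow e\in D(a,b)$; (RS5) $ad=bd$, $ae=be$, $c\in D(d,e)\Rightarrow ac=bc$; (RS6) $c\in D(a,b)\Rightarrow c\in D^t(c^2a,c^2b)$; (RS7) $D^t(a,-b)\cap D^t(b,-a)\neq\emptyset\Rightarrow a=b$; (RS8) $a\in D(b,c)\Rightarrow a^2\in D(b^2,c^2)$. Characters: $X_G$ is the set of maps $h:G\to\mathbf 3$ preserving product, $1,0,-1$, and such that $c\in D(a,b)$ implies $h(c)\in\{0,h(a),h(b)\}$. (Known duality: $c\in D(a,b)$ iff $h(c)\in\{0,h(a),h(b)\}$ for all $h\in X_G$, and $X_G$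 separates points of $G$.) Products of characters are pointwise; $Z(h):=h^{-1}[0]$. Specialization: $g\rightsquigarrow h$ iff $h^{-1}[1]\subseteq g^{-1}[1]$ (equivalently $h^2=hg$). An RS-fan is an RS $F$ such that $X_F$ is closed under products of any three of its elements. An ideal of $F$ is a nonempty $I\subseteq F$ with $F\cdot I\subseteq I$; $\mathrm{Spec}(F)$ is the set of proper ideals. Known facts for an RS-fan $F$: every TS-homomorphism $F\to\mathbf 3$ lies in $X_F$; proper ideals are prime and saturated, and are totally ordered by inclusion; each is $Z(f)$ for some $f\in X_F$; for $g\in X_F$ and a proper ideal $I\supseteq Z(g)$ there is a unique $f\in X_F$ with $g\rightsquigarrow f$ and $Z(f)=I$. Levels: for $I\in\mathrm{Spec}(F)$, $L_I=L_I(F)=\{h\in X_F: Z(h)=I\}$. Put $a\sim_I b$ iff $h(a)=h(b)$ for all $h\in L_I$; $a/I$ denotes the class of $a$; $F_I:=(F/{\sim_I})\setminus\{0/I\}=\{a/I: a\notin I\}$, a group of exponent 2 with distinguished element $-1/I$. Each $h\in L_I$ induces $\widehat h:F_I\to\{\pm1\}$, $\widehat h(a/I)=h(a)$, and $h\mapsto\widehat h$ identifies $L_I$ with the set of all group characters $F_I\to\{\pm1\}$ sending $-1$ to $-1$; thus $(L_I,F_I)$ is an abstract order space (AOS), in fact an AOS-fan. An AOS-morphism $(X,G)\to(Y,H)$ is a map $\Phi:X\to Y$ such that for every $a\in H$ there is $b\in G$ with $\widehat a\circ\Phi=\widehat b$, where $\widehat a$ denotes evaluation at $a$; an AOS-automorphism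 of $(X,G)$ is a bijection $X\to X$ which together with its inverse is an AOS-morphism. *)

(* Defs.v *)
From HB Require Import structures.
From mathcomp Require Import all_boot generic_quotient.
From mathcomp Require Import boolp classical_sets.

Set Implicit Arguments.
Unset Strict Implicit.
Unset Printing Implicit Defensive.

Local Open Scope classical_set_scope.
Local Open Scope group_scope.

Declare Scope ts_scope.
Delimit Scope ts_scope with TS.
Local Open Scope ts_scope.

HB.mixin Record Monoid_isTernarySemigroup T of Monoid T := {
  tszero : T;
  tsmone : T;
  tsmulC : forall x y : T, x * y = y * x;
  tscube : forall x : T, x ^+ 3 = x;
  tsmul0 : forall x : T, x * tszero = tszero;
  tsmone_neq1 : tsmone <> 1;
  tsmone_sq : tsmone * tsmone = 1;
  tsopp_fixed : forall x : T, x = tsmone * x -> x = tszero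
}.

#[short(type="tsType")]
HB.structure Definition TernarySemigroup :=
  {T of Monoid_isTernarySemigroup T & Monoid T}.

Definition tsopp (T : tsType) (x : T) : T := tsmone * x.

Notation "0" := tszero : ts_scope.
Notation "-1" := tsmone : ts_scope.
Notation "- x" := (tsopp x) : ts_scope.

(* D b c is the set written D(b,c); the application D b c a says a \in D(b,c). *)
Definition transverse (T : tsType) (D : T -> T -> set T) (b c : T) : set T :=
  [set a | [/\ D b c a, D (- a) c (- b) & D b (- a) (- c)]].

HB.mixin Record TernarySemigroup_isRealSemigroup G of TernarySemigroup G := {
  rsD : G -> G -> set G;
  RS0 : forall a b c : G, rsD a b c <-> rsD b a c;
  RS1 : forall a b : G, rsD a b a;
  RS2 : forall a b c d : G, rsD b c a -> rsD (b * d) (c * d) (a * d);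
  RS3 : forall a b c d e : G,
    transverse rsD b c a -> transverse rsD d e c ->
    exists2 x, transverse rsD b d x & transverse rsD x e a;
  RS4 : forall a b c d e : G, rsD (c ^+ 2 * a) (d ^+ 2 * b) e -> rsD a b e;
  RS5 : forall a b c d e : G,
    a * d = b * d -> a * e = b * e -> rsD d e c -> a * c = b * c;
  RS6 : forall a b c : G,
    rsD a b c -> transverse rsD (c ^+ 2 * a) (c ^+ 2 * b) c;
  RS7 : forall a b : G,
    transverse rsD a (- b) `&` transverse rsD b (- a) !=set0 -> a = b;
  RS8 : forall a b c : G, rsD b c a -> rsD (b ^+ 2) (c ^+ 2) (a ^+ 2)
}.

#[short(type="rsType")]
HB.structure Definition RealSemigroup :=
  {G of TernarySemigroup_isRealSemigroup G & TernarySemigroup G}.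

Inductive three := three1 | three0 | threeN1.

Definition three_mul (x y : three) : three :=
  match x, y with
  | three0, _ | _, three0 => three0
  | three1, z | z, three1 => z
  | threeN1, threeN1 => three1
  end.

Definition three_code (x : three) : option bool :=
  match x with three1 => Some true | three0 => None | threeN1 => Some false end.
Definition three_decode (x : option bool) : three :=
  match x with
  | Some true => three1 | None => three0 | Some false => threeN1
  end.
Lemma three_codeK : cancel three_code three_decode. Proof. by case. Qed.
HB.instance Definition _ := Countable.copy three (can_type three_codeK).

Lemma three_mulA : associative three_mul. Proof. by do 3!case. Qed.
Lemma three_mul1x : left_id three1 three_mul. Proof. by case. Qed.
Lemma three_mulx1 : right_id three1 three_mul. Proof. by case. Qed.
HB.instance Definition _ :=
  isMonoid.Build three three_mulA three_mul1x three_mulx1.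

Lemma three_mulC (x y : three) : x * y = y * x. Proof. by case: x y => -[]. Qed.
Lemma three_cube (x : three) : x ^+ 3 = x. Proof. by case: x. Qed.
Lemma three_mul0 (x : three) : x * three0 = three0. Proof. by case: x. Qed.
Lemma three_N1_neq1 : threeN1 <> 1 :> three. Proof. by []. Qed.
Lemma three_N1_sq : threeN1 * threeN1 = 1 :> three. Proof. by []. Qed.
Lemma three_opp_fixed (x : three) : x = threeN1 * x -> x = three0.
Proof. by case: x. Qed.
HB.instance Definition _ := Monoid_isTernarySemigroup.Build three
  three_mulC three_cube three_mul0 three_N1_neq1 three_N1_sq three_opp_fixed.

Lemma three_mul3_eq0 (x y z : three) :
  x * y * z = 0 -> y <> 0 -> z <> 0 -> x = 0.
Proof. by case: x y z => [] [] []. Qed.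

Definition is_character (G : rsType) (h : G -> three) : Prop :=
  [/\ monoid_morphism h, h 0 = 0, h (-1) = -1 &
      forall a b c, rsD a b c -> [\/ h c = 0, h c = h a | h c = h b]].

Record character (G : rsType) := Character {
  char_fun :> G -> three;
  charP : is_character char_fun
}.

Notation "''X_' G" := (character G)
  (at level 8, G at level 2, format "''X_' G") : type_scope.

Definition zero_set (G : tsType) (h : G -> three) : set G := h @^-1` [set 0].

Definition mul3 (G : Type) (f g h : G -> three) : G -> three :=
  fun a => f a * g a * h a.

Definition specializes (G : tsType) (g h : G -> three) : Prop :=
  h @^-1` [set 1] `<=` g @^-1` [set 1].
Notation "g ~~> h" := (specializes g h) (at level 70, no associativity) : ts_scope.

HB.mixin Record RealSemigroup_isFan F of RealSemigroup F := {
  fan_mul3 : forall f g h : 'X_F, is_character (mul3 f g h)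
}.

#[short(type="rsFanType")]
HB.structure Definition RSFan :=
  {F of RealSemigroup_isFan F & RealSemigroup F}.

Definition is_ideal (G : tsType) (I : set G) : Prop :=
  I !=set0 /\ forall a b : G, I b -> I (a * b).

(* In an RS-fan every proper ideal is prime and saturated, so the spectrum
   consists of all proper ideals. *)
Definition Spec (F : rsFanType) : set (set F) :=
  [set I | is_ideal I /\ I <> setT].
Arguments Spec : clear implicits.

Section Levels.
Context {F : rsFanType}.
Implicit Types (I : set F) (a b : F).

Record level I := Level {
  level_char :> 'X_F;
  level_zero_set : zero_set level_char = I
}.

Lemma level_zero I (h : level I) a : h a = 0 <-> I a.
Proof. by rewrite -[in X in _ <-> X](level_zero_set h). Qed.

Definition level_sim I : rel F :=
  fun a b => `[< forall h : level I, h a = h b >].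

Lemma level_sim_refl I : reflexive (level_sim I).
Proof. by move=> a; apply/asboolP. Qed.
Lemma level_sim_sym I : symmetric (level_sim I).
Proof. by move=> a b; apply/asboolP/asboolP => + h => /(_ h). Qed.
Lemma level_sim_trans I : transitive (level_sim I).
Proof.
by move=> b a c /asboolP ab /asboolP bc; apply/asboolP => h; rewrite ab bc.
Qed.

Canonical level_equiv I := EquivRel (level_sim I)
  (level_sim_refl I) (level_sim_sym I) (@level_sim_trans I).

Definition level_quot I := {eq_quot level_equiv I}%qT.
HB.instance Definition _ I := EqQuotient.on (level_quot I).
HB.instance Definition _ I := Choice.on (level_quot I).

(* The class a/I; level_classP characterizes equality of classes. *)
Definition level_class I a : level_quot I := (\pi_(level_quot I) a)%qT.

Lemma level_classP I a b :
  level_class I a = level_class I b <-> forall h : level I, h a = h b.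
Proof.
split=> [/(@eqmodP _ (level_equiv I))/asboolP//|ab].
by apply/(@eqmodP _ (level_equiv I))/asboolP.
Qed.

Lemma level_class_repr I (q : level_quot I) : level_class I (repr q) = q.
Proof. exact: reprK. Qed.

(* F_I = (F/~_I) \ {0/I} *)
Definition level_group I := {q : level_quot I | q != level_class I 0}.

Definition pm1 := {x : three | x != 0}.

Lemma level_eval_subproof I (h : level I) (q : level_group I) :
  h (repr (val q)) != 0.
Proof.
case: q => q /=; apply: contraNN => /eqP/level_zero Iq.
rewrite -[q]level_class_repr; apply/eqP/level_classP => k.
have [_ k0 _ _] := charP k.
by rewrite k0; apply/level_zero.
Qed.

(* \hat h : F_I -> {1,-1} *)
Definition level_eval I (h : level I) (q : level_group I) : pm1 :=
  Sub (h (repr (val q))) (level_eval_subproof h q).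

Lemma level_evalE I (h : level I) a (na : level_class I a != level_class I 0) :
  val (level_eval h (Sub (level_class I a) na)) = h a.
Proof.
by move: h; apply/level_classP; exact: level_class_repr.
Qed.

End Levels.

(* The data of an AOS (X,G) on which the notion of AOS-morphism depends: the
   set X, the set G and the evaluation X -> G -> {1,-1}.  The group law of G and
   the axioms of an AOS play no role in it. *)
Record order_space := OrderSpace {
  os_points :> Type;
  os_group : Type;
  os_eval : os_points -> os_group -> pm1
}.

Definition aos_morphism (A B : order_space) (Phi : A -> B) : Prop :=
  forall b : os_group B, exists a : os_group A,
    forall x : A, os_eval (Phi x) b = os_eval x a.

Definition aos_automorphism (A : order_space) (Phi : A -> A) : Prop :=
  exists Psi : A -> A,
    [/\ cancel Phi Psi, cancel Psi Phi, aos_morphism Phi & aos_morphism Psi].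

Definition level_space (F : rsFanType) (I : set F) : order_space :=
  @OrderSpace (level I) (level_group I) (@level_eval F I).

Section Phi.
Variables (F : rsFanType) (g1 g2 : 'X_F) (I : set F).
Hypotheses (sub1 : zero_set g1 `<=` I) (sub2 : zero_set g2 `<=` I).

Lemma phi_zero_set (h : level I) : zero_set (mul3 h g1 g2) = I.
Proof.
apply/seteqP; split => a.
  move=> e; have [/sub1//|n1] := pselect (g1 a = 0).
  have [/sub2//|n2] := pselect (g2 a = 0); apply/(level_zero h).
  exact: three_mul3_eq0 e n1 n2.
by move=> /(level_zero h) h0; rewrite /zero_set /mul3 /= h0.
Qed.

Definition phi (h : level I) : level I :=
  @Level F I (Character (fan_mul3 h g1 g2)) (phi_zero_set h).

End Phi.
Arguments phi {F} g1 g2 {I} sub1 sub2 h.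

(* Main.v *)
(* Off I the characters g1 and g2 only take the values 1 and -1.  Hence
   (g1 g2)^2 = 1 there, and h g1 g2 takes at a the value of h at a or at -a
   according to the sign of (g1 g2)(a), which does not depend on h; this gives
   the involution and the AOS-morphism property.  Specialization g ~~> h means
   that g and h agree wherever h does not vanish, which gives the rest. *)

Require Import Defs.
From mathcomp Require Import all_boot.
From mathcomp Require Import boolp classical_sets.
Local Open Scope classical_set_scope.
Local Open Scope ts_scope.

Set Implicit Arguments.
Unset Strict Implicit.

Lemma charN (G : rsType) (h : 'X_G) (a : G) : h (- a) = - (h a).
Proof. by have [[_ hM] _ hN1 _] := charP h; rewrite /tsopp hM hN1. Qed.

(** Specialization only transfers the value 1; the value -1 of [h] at [a] is handled by passing to
    [- a]. *)
Lemma specializes_eq (G : rsType) (g h : 'X_G) (a : G) :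
  g ~~> h -> h a <> 0 -> g a = h a.
Proof.
move=> gh; case ha: (h a) => // _; first exact: gh ha.
have /gh : h (- a) = 1%g by rewrite charN ha.
by rewrite /= charN; case: (g a).
Qed.

Lemma level_inj (F : rsFanType) (I : set F) (h k : level I) :
  h =1 k -> h = k.
Proof.
case: h k => [[h hc] hI] [[k kc] kI] /= /funext hk; case: _ / hk in kc kI *.
rewrite (Prop_irrelevance hc kc) in hI *.
by rewrite (Prop_irrelevance hI kI).
Qed.

(** All characters of the level vanish on [I], so a representative in [I] would make [q] the zero
    class. *)
Lemma level_group_repr (F : rsFanType) (I : set F) (q : level_group I) :
  ~ I (repr (val q)).
Proof.
move=> Iq; have /eqP := valP q; apply.
rewrite -[LHS]level_class_repr; apply/level_classP => h.
by have [_ -> _ _] := charP h; apply/level_zero.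
Qed.

(** Negation does not affect vanishing; this makes the negative of [q] available as an element of
    the group. *)
Lemma level_classN_neq0 (F : rsFanType) (I : set F) (q : level_group I) :
  level_class I (- repr (val q)) != level_class I 0.
Proof.
apply/eqP => /level_classP N0; have /eqP := valP q; apply.
rewrite -[LHS]level_class_repr; apply/level_classP => h.
by have := N0 h; rewrite charN; have [_ -> _ _] := charP h; case: (h _).
Qed.

Section Phi.
Variables (F : rsFanType) (g1 g2 : 'X_F) (I : set F).
Hypotheses (sub1 : zero_set g1 `<=` I) (sub2 : zero_set g2 `<=` I).

Local Notation phiI := (phi g1 g2 sub1 sub2).

Lemma phiK : involutive phiI.
Proof.
move=> h; apply: level_inj => a; rewrite /= /mul3 /= /mul3.
have [Ia|nIa] := pselect (I a); first by rewrite (level_zero h a).2.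
have n1 : g1 a <> 0 by move/sub1.
have n2 : g2 a <> 0 by move/sub2.
by case: (g1 a) (g2 a) n1 n2 => -[] // _ _; case: (h a).
Qed.

Lemma phi_aos_morphism : @aos_morphism (level_space I) (level_space I) phiI.
Proof.
move=> q /=; have nIq := @level_group_repr F I q.
(* The value picks the witness: [q] itself for 1, the class of the negated representative for -1.
   The value 0 is impossible, as the representative lies outside [I]. *)
case e: (g1 (repr (val q)) * g2 (repr (val q)))%g.
- exists q => h; apply: val_inj.
  by rewrite /= /mul3 -mulgA e; case: (h _).
- have n1 : g1 (repr (val q)) <> 0 by move/sub1.
  have n2 : g2 (repr (val q)) <> 0 by move/sub2.
  by case: (g1 _) (g2 _) e n1 n2 => -[].
- exists (Sub (level_class I _) (level_classN_neq0 q) : level_group I) => h; apply: val_inj.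
  by rewrite level_evalE charN /= /mul3 -mulgA e; case: (h _).
Qed.

(** Off [I] the product becomes [h1 * h1 * h2], where the square of [h1] is 1; on [I] both sides
    vanish. *)
Lemma phi_specializes (h1 h2 : level I) :
  g1 ~~> h1 -> g2 ~~> h2 -> phiI h1 = h2.
Proof.
move=> gh1 gh2; apply: level_inj => a /=; rewrite /mul3.
have [Ia|nIa] := pselect (I a).
  by rewrite (level_zero h1 a).2 // (level_zero h2 a).2.
have n1 : h1 a <> 0 by move/level_zero.
have n2 : h2 a <> 0 by move/level_zero.
rewrite (specializes_eq gh1 n1) (specializes_eq gh2 n2).
by case: (h1 a) n1 (h2 a) => // _ [].
Qed.

End Phi.

Lemma phi_mono (F : rsFanType) (g1 g2 : 'X_F) (I J : set F)
    (sub1 : zero_set g1 `<=` I) (sub2 : zero_set g2 `<=` I)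
    (subJ1 : zero_set g1 `<=` J) (subJ2 : zero_set g2 `<=` J)
    (h1 : level J) (h2 : level I) :
  h1 ~~> h2 -> phi g1 g2 subJ1 subJ2 h1 ~~> phi g1 g2 sub1 sub2 h2.
Proof.
move=> h12 a; rewrite /= /mul3 => e.
(* The product in [e] is 1, so [h2 a] is nonzero and [h1 a] equals it. *)
by rewrite (specializes_eq h12) // => h2a; rewrite h2a in e.
Qed.

Theorem theorem2p8 (F : rsFanType) (g1 g2 : 'X_F) (I : set F)
    (specI : Spec F I)
    (sub1 : zero_set g1 `<=` I) (sub2 : zero_set g2 `<=` I) :
  [/\ @aos_automorphism (level_space I) (phi g1 g2 sub1 sub2),
      forall h : level I,
        phi g1 g2 sub1 sub2 (phi g1 g2 sub1 sub2 h) = h,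
      forall h1 h2 : level I,
        g1 ~~> h1 -> g2 ~~> h2 ->
        phi g1 g2 sub1 sub2 h1 = h2,
      forall h : level I,
        g1 ~~> h -> g2 ~~> h ->
        phi g1 g2 sub1 sub2 h = h
    & forall (J : set F) (specJ : Spec F J) (JI : J `<=` I)
        (subJ1 : zero_set g1 `<=` J) (subJ2 : zero_set g2 `<=` J)
        (h1 : level J) (h2 : level I),
        h1 ~~> h2 ->
        phi g1 g2 subJ1 subJ2 h1 ~~> phi g1 g2 sub1 sub2 h2].
Proof.
split.
(* An involution is its own inverse. *)
- by exists (phi g1 g2 sub1 sub2); split; try exact: phiK;
    exact: phi_aos_morphism.
- exact: phiK.
- exact: phi_specializes.
- by move=> h; exact: phi_specializes.
- by move=> J _ _ subJ1 subJ2 h1 h2; exact: phi_mono.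
Qed.
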